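(* Let $G$ be a finite group and let $\varphi:G\to G$ be a group endomorphism, with state space $\Gamma_\varphi$. Then the dual digraph $\Gamma_{\varphi}^{\ast}$ has rigid procreation.
   Context: Let $\mathbb{N}$ be the natural numbers including $0$, and $\mathbb{N}^+$ the positive integers. The state space $\Gamma_\varphi$ is the digraph with vertex set $G$ having a directed edge from $x$ to $y$ if and only if $y=\varphi(x)$ (loops allowed). For a digraph $\Gamma=(V,E)$, the dual digraph is $\Gamma^{\ast}=(V,E^{-1})$ with $E^{-1}=\{(y,x)\mid (x,y)\in E\}$. Let $\Gamma=(V,E)$ be a finite digraph and $v\in V$. A vertex $w$ with $(v,w)\in E$ is called a successor or child of $v$ (in particular, $v$ is a child of itself if it has a loop). A vertex $c$ has (at least) $n$ successor generations, $n\in\mathbb{N}$, if there is a directed path $(w_1,\ldots,w_{n+1})$ in $\Gamma$ with $w_1=c$; here vertices on a path may repeat (so vertices on directed cycles have infinitely many successor generations). The procreation behavior of $v$ is the sequence $(a_k)_{k\in\mathbb{N}^+}$ where $a_k$ (the $k$-th procreation number of $v$) is the number of children $c$ of $v$ which have at least $k-1$ successor generations. For $n\in\mathbb{N}$, the procreation behavior of length $n$ of $v$ is the $n$-tuple consisting of the first $n$ procreation numbers of $v$. $\Gamma$ has rigid procreation if and only if for all $v,w\in V$ and all $n\in\mathbb{N}$ such that $v$ and $w$ both have (at least) $n$ successor generations, the procreation behaviors of length $n$ of $v$ and $w$ are equal. *)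

(* Defs.v *)
From mathcomp Require Import all_boot all_order all_fingroup.

Set Implicit Arguments.
Unset Strict Implicit.
Unset Printing Implicit Defensive.

(* A finite digraph (loops allowed) is a relation e : rel V on a finType V,
   where e x y says that there is an edge from x to y. *)

Definition state_space (T : finType) (phi : T -> T) : rel T :=
  [rel x y | y == phi x].

Definition dual_digraph (V : finType) (e : rel V) : rel V :=
  [rel x y | e y x].

(* The n + 1 vertices of the directed path are c followed by the entries of p;
   they need not be distinct. *)
Definition has_generations (V : finType) (e : rel V) (n : nat) (c : V) : bool :=
  [exists p : n.-tuple V, path e c p].

(* Only meaningful for k >= 1. *)
Definition procreation_number (V : finType) (e : rel V) (v : V) (k : nat) : nat :=
  #|[set c : V | e v c & has_generations e k.-1 c]|.

(* Tuples are indexed from 0, so the entry at position i is the procreation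
   number of index i + 1. *)
Definition procreation_behavior (V : finType) (e : rel V) (n : nat) (v : V) :
    n.-tuple nat :=
  [tuple procreation_number e v i.+1 | i < n].

Definition rigid_procreation (V : finType) (e : rel V) : Prop :=
  forall (v w : V) (n : nat),
    has_generations e n v -> has_generations e n w ->
    procreation_behavior e n v = procreation_behavior e n w.

(* Main.v *)
Require Import Defs.
From mathcomp Require Import all_boot all_order all_fingroup.

(** In the dual of the state space of [phi], the children of [v] are its
    preimages under [phi], and the vertices with at least [n] successor
    generations are the values of the [n]-th iterate of [phi]
    ([has_generations_dualP]). Hence the number of children of [v] with [k]
    generations is the size of the fibre over [v] of [phi] restricted to the
    image of its [k]-th iterate. When [phi] is an endomorphism this image is a
    subgroup, so every nonempty fibre is a coset of the kernel of that
    restriction, and its size does not depend on [v] ([card_fibre_iter]). The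
    fibre is nonempty exactly when [v] is a value of the iterate of order
    [k + 1], that is, when [v] has [k + 1] generations; rigidity compares
    these sizes only at vertices with that many generations. *)

Lemma has_generationsS (V : finType) (e : rel V) (n : nat) (c : V) :
  has_generations e n.+1 c = [exists y, e c y && has_generations e n y].
Proof.
apply/existsP/existsP => [[p] | [y /andP[ecy /existsP[p ep]]]].
  case/tupleP: p => y p /= /andP[ecy ep].
  by exists y; rewrite ecy; apply/existsP; exists p.
by exists [tuple of y :: p]; rewrite /= ecy.
Qed.

Lemma has_generations_dualP (T : finType) (phi : T -> T) (n : nat) (c : T) :
  reflect (exists x, c = iter n phi x)
          (has_generations (dual_digraph (state_space phi)) n c).
Proof.
elim: n c => [|n IHn] c.
  by apply: (iffP existsP) => _; [exists c | exists [tuple]].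
rewrite has_generationsS; apply: (iffP existsP) => [[y] | [x ->]].
  by case/andP=> /eqP -> /IHn[x ->]; exists x.
by exists (iter n phi x); apply/andP; split; [exact: eqxx | apply/IHn; exists x].
Qed.

Section Endomorphism.

Variables (gT : finGroupType) (phi : {morphism [set: gT] >-> gT}).

Lemma iter_endoM (k : nat) : {morph iter k phi : x y / (x * y)%g}.
Proof. by elim: k => // k IHk x y; rewrite /= IHk morphM ?inE. Qed.

Lemma iter_endoV (k : nat) : {morph iter k phi : x / (x^-1)%g}.
Proof. by elim: k => // k IHk x; rewrite /= IHk morphV ?inE. Qed.

(** Right translation by [iter k phi x] carries the kernel of [phi] restricted
    to the image of [iter k phi] onto its fibre over [phi (iter k phi x)]. *)
Lemma card_fibre_iter (k : nat) (x : gT) :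
  #|[set c in codom (iter k phi) | phi c == iter k.+1 phi x]|
    = #|[set c in codom (iter k phi) | phi c == 1%g]|.
Proof.
rewrite -[RHS](card_rcoset _ (iter k phi x)); apply: eq_card => c.
rewrite mem_rcoset !inE morphM ?morphV ?in_setT // -eq_mulgV1; congr (_ && _).
apply/codomP/codomP => [[y ->] | [y cxE]].
  by exists (y * x^-1)%g; rewrite iter_endoM iter_endoV.
by exists (y * x)%g; rewrite iter_endoM -cxE mulgKV.
Qed.

Lemma procreation_number_dual (v : gT) (k : nat) :
  procreation_number (dual_digraph (state_space phi)) v k.+1
    = #|[set c in codom (iter k phi) | phi c == v]|.
Proof.
apply: eq_card => c; rewrite !inE /= eq_sym andbC; congr (_ && _).
by apply/has_generations_dualP/codomP.
Qed.

Lemma procreation_number_dual_const (v : gT) (n k : nat) :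
    k < n -> has_generations (dual_digraph (state_space phi)) n v ->
  procreation_number (dual_digraph (state_space phi)) v k.+1
    = #|[set c in codom (iter k phi) | phi c == 1%g]|.
Proof.
move=> lt_kn /has_generations_dualP[x ->]; rewrite procreation_number_dual.
by rewrite -(subnKC lt_kn) iterD card_fibre_iter.
Qed.

End Endomorphism.

Theorem theorem3 (gT : finGroupType) (phi : {morphism [set: gT] >-> gT}) :
  rigid_procreation (dual_digraph (state_space phi)).
Proof.
move=> v w n gen_v gen_w; apply: eq_from_tnth => i; rewrite !tnth_mktuple.
by rewrite !(@procreation_number_dual_const _ _ _ n).
Qed.
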